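(* Let $M$ be an irreversible halting Turing machine of the single-binary-tape form described in the context, using storage space $S$ and, on inputs of length $n$, $T$ steps on average. Suppose a reversible Turing machine of the same form, having $q'$ states, generally simulates the computation of $M$ on inputs of length $n$, using storage space $S'$ and $T'$ steps on average. Then $$T' \ge T \qquad\text{and}\qquad S' \ge n + \log T - O(1)\ \text{ up to a logarithmic additive term},$$ that is, $S' \ge n+\log T - O(\log S') - O(1)$, where the $O(1)$ constant depends only on $q'$.
   Context: Logarithms are to base 2. Machine model: a Turing machine with a single binary work tape delimited by markers $\dagger,\ddagger$ that are placed $S$ positions apart ($S'$ positions apart for the simulator) and are never moved. Initially the binary input of length $n$ is written left adjusted on the work tape; at the end of the computation the output is written left adjusted on the work tape. Only halting computations performing a mapping from an input to an output are considered. The average number of steps is the uniform average over all $2^n$ equally likely inputs of $n$ bits. A reversible Turing machine is a deterministic one in which every configuration has at most one predecessor. (Precisely: rules are read/write quadruples $(p,a,b,q)$ --- in state $p$ scanning $a$, write $b$ and enter state $q$ --- and move quadruples $(p,\ast,\sigma,q)$, $\sigma\in\{-1,+1\}$ --- in state $p$, move the head by $\sigma$ and enter state $q$; no two rules apply in the same state to the same scanned symbol with different actions, and any two distinct rules entering the same state must both be read/write rules writing different symbols.) Reversible simulation of a computation taking input $x$ to $f(x)$ means that the reversible machine computes from input $x$ to output $\langle x,f(x)\rangle$. A general simulation is one that does not use the semantics of the function being computed but simulates every step of the simulated machine: on each input, the computation of the simulator contains at least one distinct step for each step of the simulated computation on that input. *)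

(* Defs.v *)
From mathcomp Require Import all_boot all_order all_algebra.
From mathcomp Require Import reals exp.

Set Implicit Arguments.
Unset Strict Implicit.
Unset Printing Implicit Defensive.

Import Order.TTheory GRing.Theory Num.Theory.

Inductive symbol := Bit of bool | LMark | RMark.

Inductive direction := Left | Right.

(* [ReadWrite p a b q]: in state p scanning a, write b and enter state q.
   [Move p d q]: in state p, whatever is scanned, move the head one position
   in direction d and enter state q. *)
Inductive rule (Q : Type) :=
  | ReadWrite of Q & symbol & symbol & Q
  | Move of Q & direction & Q.

Record machine := Machine {
  state : finType;
  start : state;
  rules : rule state -> bool
}.

Definition applies (Q : Type) (r : rule Q) (p : Q) (a : symbol) : Prop :=
  match r with
  | ReadWrite p0 a0 _ _ => p0 = p /\ a0 = a
  | Move p0 _ _ => p0 = p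
  end.

Definition target (Q : Type) (r : rule Q) : Q :=
  match r with
  | ReadWrite _ _ _ q => q
  | Move _ _ q => q
  end.

Definition write_different (Q : Type) (r1 r2 : rule Q) : Prop :=
  match r1, r2 with
  | ReadWrite _ _ b1 _, ReadWrite _ _ b2 _ => b1 <> b2
  | _, _ => False
  end.

Definition deterministic (M : machine) : Prop :=
  forall (r1 r2 : rule (state M)) (p : state M) (a : symbol),
    rules r1 -> rules r2 -> applies r1 p a -> applies r2 p a -> r1 = r2.

Definition reversible (M : machine) : Prop :=
  deterministic M /\
  forall r1 r2 : rule (state M),
    rules r1 -> rules r2 -> r1 <> r2 -> target r1 = target r2 ->
    write_different r1 r2.

(* A configuration with storage space S: the S binary cells occupy the
   positions 1, ..., S, the markers the positions 0 and S + 1, and the head is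
   on one of these S + 2 positions. *)
Record config (M : machine) (S : nat) := Config {
  cstate : state M;
  chead : 'I_S.+2;
  cbits : S.-tuple bool
}.

Definition tape (S : nat) (w : S.-tuple bool) : seq symbol :=
  LMark :: rcons (map Bit w) RMark.

Definition scanned (M : machine) (S : nat) (c : config M S) : symbol :=
  nth LMark (tape (cbits c)) (chead c).

(* The markers never move: writing is possible only if the new tape is again
   of the form [tape w'].  A rule that would displace a marker, or move the
   head beyond a marker, yields no successor; the machine is then stuck, which
   does not count as halting (see [halted]). *)
Inductive step (M : machine) (S : nat) : config M S -> config M S -> Prop :=
  | StepReadWrite p a b q i w w' :
      rules (ReadWrite p a b q) ->
      scanned (Config p i w) = a ->
      tape w' = set_nth LMark (tape w) i b ->
      step (Config p i w) (Config q i w')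
  | StepMove p d q (i j : 'I_S.+2) w :
      rules (Move p d q) ->
      match d with
      | Left => i = j.+1 :> nat
      | Right => j = i.+1 :> nat
      end ->
      step (Config p i w) (Config q j w).

Definition halted (M : machine) (S : nat) (c : config M S) : Prop :=
  forall r : rule (state M), rules r -> ~ applies r (cstate c) (scanned c).

(* [halting_run c cs]: started in c, the machine successively enters the
   configurations listed in cs and halts in the last one; it makes size cs
   steps. *)
Fixpoint halting_run (M : machine) (S : nat) (c : config M S)
    (cs : seq (config M S)) : Prop :=
  match cs with
  | [::] => halted c
  | c' :: cs' => step c c' /\ halting_run c' cs'
  end.

(* The input is left adjusted, the remaining cells contain 0, and the head
   scans the first cell (the right marker if S = 0). *)
Definition initial (M : machine) (S n : nat) (x : n.-tuple bool) : config M S :=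
  Config (start M) (inord 1) [tuple nth false x i | i < S].

(* With storage space S, M maps each input x of n bits to the output g x, the
   computation on x being the run [comp x].  The cells after the output are
   unconstrained. *)
Definition computes (M : machine) (S n : nat) (g : n.-tuple bool -> seq bool)
    (comp : n.-tuple bool -> seq (config M S)) : Prop :=
  (n <= S)%N /\
  forall x : n.-tuple bool,
    halting_run (initial M S x) (comp x) /\
    prefix (g x) (cbits (last (initial M S x) (comp x))).

(* On each input, the steps of the simulated computation are assigned pairwise
   distinct steps of the simulating computation. *)
Definition simulates_every_step (M M' : machine) (S S' n : nat)
    (comp : n.-tuple bool -> seq (config M S))
    (comp' : n.-tuple bool -> seq (config M' S')) : Prop :=
  forall x : n.-tuple bool,
    exists h : 'I_(size (comp x)) -> 'I_(size (comp' x)), injective h.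

Local Open Scope ring_scope.

Definition average_steps (R : realType) (M : machine) (S n : nat)
    (comp : n.-tuple bool -> seq (config M S)) : R :=
  (\sum_(x : n.-tuple bool) (size (comp x))%:R) / 2 ^+ n.

(* log2 0 = 0, since [ln] is 0 there. *)
Definition log2 (R : realType) (x : R) : R := ln x / ln 2.

(* Main.v *)
Require Import Defs.
From mathcomp Require Import all_boot all_order all_algebra.
From mathcomp Require Import reals exp.
From mathcomp Require Import zify lra.

Import Order.TTheory GRing.Theory Num.Theory.

(** From a configuration the rest of a deterministic run is forced, so a
    configuration [c] of the run on [x] determines the remaining number of
    steps and the final tape.  The output [g x] is a prefix of that tape, hence
    determined by its length; as [g] is injective, [c] and the length of [g x]
    determine [x] and the time at which [c] occurs.  Counting configurations,
    [2^n T' <= q' (S' + 2) 2^S' (S' + 1)], and one takes logarithms.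
    Allowing for all [S' + 1] output lengths makes up for [pairing] not being
    prefix-free. *)

Lemma tape_inj S : injective (@tape S).
Proof.
move=> w w' [] /rcons_inj [] /inj_map E.
by apply: val_inj; apply: E => a b [].
Qed.

(** Inversion phrased through the projections of [c] and [c'], so that two steps from one
    configuration can be compared rule by rule; it also shows that a configuration with a successor
    is not halted. *)
Lemma step_inv {M S} {c c' : config M S} :
  step c c' ->
  exists r, [/\ rules r, applies r (cstate c) (scanned c),
    target r = cstate c' &
    match r with
    | ReadWrite _ _ b _ => chead c' = chead c /\
        tape (cbits c') = set_nth LMark (tape (cbits c)) (chead c) b
    | Move _ d _ => cbits c' = cbits c /\
        match d with
        | Left => chead c = (chead c').+1 :> nat
        | Right => chead c' = (chead c).+1 :> nat
        end
    end].
Proof.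
case=> [p a b q i w w' rr sc tw|p d q i j w rr ij].
- by exists (ReadWrite p a b q).
- by exists (Move p d q).
Qed.

Lemma step_det {M S} {c c1 c2 : config M S} :
  deterministic M -> step c c1 -> step c c2 -> c1 = c2.
Proof.
move=> dM /step_inv [r [rr ra rt re]] /step_inv [r' [rr' ra' rt' re']].
have E := dM _ _ _ _ rr rr' ra ra'; subst r'.
case: c1 c2 rt re rt' re' => [q1 i1 w1] [q2 i2 w2] /= -> re ->.
case: r {rr ra rr' ra'} re => [p a b q|p d q] /= [E1 E2] [E1' E2'].
- by rewrite E1 E1'; congr Config; apply: tape_inj; rewrite E2 E2'.
- rewrite E1 E1'; congr Config; apply: val_inj.
  by case: d E2 E2' => /= [-> []|-> ->].
Qed.

Lemma halting_run_det {M S} {c : config M S} {cs cs' : seq (config M S)} :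
  deterministic M -> halting_run c cs -> halting_run c cs' -> cs = cs'.
Proof.
move=> dM; elim: cs cs' c => [|c1 cs IH] [|c2 cs'] c //=.
- by move=> hc [/step_inv [r [rr ar _ _]] _]; case: (hc r rr).
- by move=> [/step_inv [r [rr ar _ _]] _] hc; case: (hc r rr).
- move=> [s1 h1] [s2 h2]; have E := step_det dM s1 s2.
  by rewrite -E in h2 *; rewrite (IH _ _ h1 h2).
Qed.

(** The lookup is in [c :: cs] so that index [i] means time [i], with [c] at time 0. *)
Lemma halting_run_drop {M S} {c : config M S} {cs i} :
  i <= size cs -> halting_run c cs ->
  halting_run (nth c (c :: cs) i) (drop i cs).
Proof.
elim: cs c i => [|c1 cs IH] c [|i] //= le_i [_ h1].
by rewrite (set_nth_default c1) ?ltnS //; apply: IH.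
Qed.

Lemma last_drop {A} (c : A) {cs i} :
  i <= size cs -> last (nth c (c :: cs) i) (drop i cs) = last c cs.
Proof.
elim: cs c i => [|c1 cs IH] c [|i] //= le_i.
by rewrite (set_nth_default c1) ?ltnS ?IH.
Qed.

Lemma total_steps_le {M S n} {g : n.-tuple bool -> seq bool}
    {comp : n.-tuple bool -> seq (config M S)} :
  deterministic M -> injective g -> computes g comp ->
  \sum_x size (comp x) <= #|state M| * S.+2 * 2 ^ S * S.+1.
Proof.
move=> dM g_inj [_ runs].
pose conf x i := nth (initial M S x) (initial M S x :: comp x) i.
(* The times range over the starts of steps, so the halting configuration is left out and the domain
   has one element per step. [inord] loses nothing, as an output has length at most [S]. *)
pose code (u : {x : n.-tuple bool & 'I_(size (comp x))}) :=
  let c := conf (tag u) (tagged u) in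
  (cstate c, chead c, cbits c, inord (size (g (tag u))) : 'I_S.+1).
have size_g x : size (g x) < S.+1.
  by have [_ /size_prefix] := runs x; rewrite size_tuple.
suff code_inj : injective code.
  have := leq_card code code_inj.
  by rewrite card_tagged !card_prod !card_ord card_tuple card_bool sumnE
     big_map big_enum /=; under eq_bigr do rewrite card_ord.
move=> [x i] [y j] [] /=.
case E1: (conf x i) => [p h w]; case E2: (conf y j) => [p' h' w'] /= Ep Eh Ew Es.
have Ec : conf x i = conf y j by rewrite E1 E2 Ep Eh Ew.
have {}Es : size (g x) = size (g y).
  by rewrite -(inordK (size_g x)) Es inordK.
have [[hx px] [hy py]] := (runs x, runs y).
have [lei lej] := (ltnW (ltn_ord i), ltnW (ltn_ord j)).
have rx := halting_run_drop lei hx.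
have ry := halting_run_drop lej hy.
rewrite -/(conf x i) -/(conf y j) Ec in rx ry.
have Ed := halting_run_det dM rx ry.
have El : last (initial M S x) (comp x) = last (initial M S y) (comp y).
  rewrite -(last_drop _ lei) -(last_drop _ lej).
  by rewrite -/(conf x i) -/(conf y j) Ec Ed.
(* Prefixes of equal length of the same final tape coincide, so [g x = g y]. *)
have Exy : x = y.
  by apply: g_inj; move: px py; rewrite !prefixE El Es => /eqP <- /eqP.
subst y; congr Tagged; apply: val_inj => /=.
(* Equally many steps remain out of the same total; both times lie below it, so the truncated
   subtraction is harmless. *)
have /eqP := congr1 size Ed; rewrite !size_drop => /eqP.
by have := (ltn_ord i, ltn_ord j); lia.
Qed.

Local Open Scope ring_scope.

Lemma average_steps_le {R : realType} {M M' S S' n}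
    {comp : n.-tuple bool -> seq (config M S)}
    {comp' : n.-tuple bool -> seq (config M' S')} :
  simulates_every_step comp comp' ->
  average_steps R comp <= average_steps R comp'.
Proof.
move=> sim; rewrite ler_wpM2r ?invr_ge0 ?exprn_ge0 //.
apply: ler_sum => x _; rewrite ler_nat.
by have [h /leq_card] := sim x; rewrite !card_ord.
Qed.

Theorem theorem2 (R : realType) :
  exists (K : R) (C : nat -> R),
  forall (n S S' q' : nat) (M M' : machine)
    (f : n.-tuple bool -> seq bool)
    (pairing : n.-tuple bool * seq bool -> seq bool)
    (comp : n.-tuple bool -> seq (config M S))
    (comp' : n.-tuple bool -> seq (config M' S'))
    (T T' : R),
  deterministic M -> ~ reversible M ->
  computes f comp ->
  T = average_steps R comp ->
  reversible M' -> #|state M'| = q' ->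
  injective pairing ->
  computes (fun x => pairing (x, f x)) comp' ->
  simulates_every_step comp comp' ->
  T' = average_steps R comp' ->
  T <= T' /\
  n%:R + log2 T - K * log2 (S'%:R : R) - C q' <= S'%:R.
Proof.
(* Both come from [S'.+2 * S'.+1 <= 6 * m ^ 2] with [m = maxn 1 S'], an equality at [S' = 1]: the
   square gives the 2, and the 6 joins the number of states. *)
exists 2, (fun q => log2 (6 * q)%:R).
move=> n S S' q' M M' f pairing comp comp' T T' _ _ _ ET [dM' _] Eq pair_inj
  cM' sim ET'.
have leT : T <= T' by rewrite ET ET'; exact: average_steps_le.
split=> //.
have q_gt0 : (0 < q')%N by rewrite -Eq; apply/card_gt0P; exists (start M').
have le_n : (n <= S')%N by case: cM'.
(* The input is recoverable because it is a component of the pair. *)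
have g_inj : injective (fun x => pairing (x, f x)) by move=> x y /pair_inj [].
have total := total_steps_le dM' g_inj cM'; rewrite Eq in total.
have ln2 : 0 < ln (2 : R) by rewrite ln_gt0 // ltr1n.
(* This keeps the argument of the logarithm positive; at [S' = 0] both logarithms are 0, that of 0
   by convention. *)
pose m := maxn 1 S'.
have m_gt0 : (0 < m)%N by rewrite leq_max.
have -> : log2 S'%:R = log2 m%:R :> R.
  by rewrite /m; case: (S') => [|k]; [rewrite /log2 ln0 ?ln1|rewrite (maxn_idPr _)].
have log_ge0 k : (0 < k)%N -> 0 <= log2 (k%:R : R).
  by move=> k_gt0; apply: divr_ge0 (ltW ln2); rewrite ln_ge0 // ler1n.
(* Here [log2 T] takes its default value 0, and [n <= S'] suffices. *)
have [T_le0|T_gt0] := leP T 0.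
  have -> : log2 T = 0 by rewrite /log2 ln0 // mul0r.
  have : n%:R <= S'%:R :> R by rewrite ler_nat.
  have := log_ge0 _ m_gt0.
  have : 0 <= log2 ((6 * q')%:R : R) by apply: log_ge0; lia.
  lra.
have bound : T * 2 ^+ n <= (6 * q')%:R * m%:R ^+ 2 * 2 ^+ S'.
  apply: le_trans (_ : T' * 2 ^+ n <= _).
    by rewrite ler_wpM2r // exprn_ge0.
  rewrite ET' /average_steps mulfVK ?expf_neq0 ?pnatr_eq0 //.
  rewrite -natr_sum -!natrX -!natrM ler_nat (leq_trans total) //.
  have: (S'.+2 * S'.+1 <= 6 * m ^ 2)%N by rewrite /m; nia.
  move: (2 ^ S')%N => e; nia.
have pow_gt0 k : 0 < 2 ^+ k :> R by rewrite exprn_gt0.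
have qR : 0 < (6 * q')%:R :> R by rewrite ltr0n; lia.
have mR : 0 < m%:R :> R by rewrite ltr0n.
have lnle : ln (T * 2 ^+ n) <= ln ((6 * q')%:R * m%:R ^+ 2 * 2 ^+ S').
  by rewrite ler_ln ?posrE ?mulr_gt0 ?exprn_gt0.
move: lnle; rewrite !lnM ?posrE ?mulr_gt0 ?exprn_gt0 // !lnXn //.
rewrite -!(mulr_natl (ln _)) => lnle.
(* Multiplying by [ln 2] clears the denominators and leaves a goal linear in natural logarithms. *)
rewrite -(ler_pM2r ln2) /log2 !mulrBl mulrDl mulrA !mulfVK ?gt_eqF //.
lra.
Qed.
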